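(* Let $I\subset(0,\infty)$ be a closed bounded interval, let $J\subseteq\mathbb{R}$ with $[0,1]\subseteq J$, let $h:J\to\mathbb{R}$ be a nonnegative function, and let $f,g:I\to(0,\infty)$ be $h$-geometrically convex functions on $I$. Let $p>1$ and $\frac1p+\frac1q=1$. Then for every $x,y\in I$ with $x<y$, $$\int_0^1 f(x^t y^{1-t})\,g(x^{1-t}y^t)\,dt\le \left(\int_0^1 f(x)^{p^2h(t)}dt\right)^{\frac{1}{p^2}}\left(\int_0^1 g(y)^{pq\,h(t)}dt\right)^{\frac{1}{pq}}\left(\int_0^1 f(y)^{pq\,h(1-t)}dt\right)^{\frac{1}{pq}}\left(\int_0^1 g(x)^{q^2h(1-t)}dt\right)^{\frac{1}{q^2}}.$$
   Context: A positive function $f$ on an interval $I\subset(0,\infty)$ is called $h$-geometrically convex if for all $x,y\in I$ and $t\in[0,1]$, $f(x^t y^{1-t})\le [f(x)]^{h(t)}[f(y)]^{h(1-t)}$, where $h:J\to\mathbb{R}$ is a nonnegative function on $J\subseteq\mathbb{R}$. *)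

(* Defs.v *)
From HB Require Import structures.
From mathcomp Require Import all_boot all_order all_algebra.
From mathcomp Require Import all_classical all_reals all_analysis.

Set Implicit Arguments.
Unset Strict Implicit.
Unset Printing Implicit Defensive.

Import Order.TTheory GRing.Theory Num.Theory.
Import numFieldNormedType.Exports.

Local Open Scope classical_set_scope.
Local Open Scope ring_scope.

(* f and h are total functions; only the values of f on I, and of h on `[0, 1],
   are ever used for I an interval of positive reals. *)
Definition h_geometrically_convex (R : realType) (h : R -> R) (I : set R)
    (f : R -> R) : Prop :=
  (forall x, I x -> 0 < f x) /\
  (forall x y t, I x -> I y -> 0 <= t <= 1 ->
    f (x `^ t * y `^ (1 - t)) <= f x `^ h t * f y `^ h (1 - t)).

(* The Lebesgue sigma-algebra (that of completed_lebesgue_measure), rather than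
   the Borel one carried by R, so that in particular every Riemann-integrable
   function on `[0, 1] is measurable. *)
Definition lebesgue_measurable_fun (R : realType) (D : set R) (u : R -> R)
    : Prop :=
  @measurable_fun _ _ (caratheodory_type (@wlength R idfun)^*%mu) R D u.

Definition integral01 (R : realType) (u : R -> R) : \bar R :=
  (\int[@completed_lebesgue_measure R]_(t in `[0%R, 1%R]) (u t)%:E)%E.

(* Main.v *)
(* Geometric convexity at (x, y, t) and (x, y, 1 - t) bounds the integrand by
   [f(x)^h(t) g(y)^h(t) f(y)^h(1-t) g(x)^h(1-t)]. Hoelder's inequality with
   exponents (p, q) separates the first two factors from the last two, and two
   further applications, with (p, q) again, separate the factors in each pair. *)

Require Import Defs.
From HB Require Import structures.
From mathcomp Require Import all_boot all_order all_algebra.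
From mathcomp Require Import all_classical all_reals all_analysis.
From mathcomp Require Import measurable_realfun.

Set Implicit Arguments.
Unset Strict Implicit.
Unset Printing Implicit Defensive.

Import Order.TTheory GRing.Theory Num.Theory.
Import numFieldNormedType.Exports.

Local Open Scope classical_set_scope.
Local Open Scope ring_scope.

Section integral_inequalities.
Context d (T : measurableType d) (R : realType).
Variables (mu : {measure set T -> \bar R}) (D : set T).

(* [ge0_le_integral] asks for measurability, which the integrand of
   [theorem6] may lack, but the integral of a nonnegative function is a
   supremum over the simple functions below it, hence monotone on all
   nonnegative functions. *)
Lemma ge0_le_integral_nomeas (f1 f2 : T -> \bar R) :
  (forall x, D x -> 0 <= f1 x)%E -> (forall x, D x -> f1 x <= f2 x)%E ->
  (\int[mu]_(x in D) f1 x <= \int[mu]_(x in D) f2 x)%E.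
Proof.
move=> f10 f12.
have f20 x : D x -> (0 <= f2 x)%E.
  by move=> Dx; exact: le_trans (f10 _ Dx) (f12 _ Dx).
rewrite !ge0_integralE//; apply: ereal_sup_le => _ [u /= uf <-].
exists u => // x; apply: le_trans (uf x) _.
by rewrite /patch; case: ifPn => // /set_mem; exact: f12.
Qed.

Hypothesis mD : measurable D.

(** This is [hoelder] for the restrictions of [u] and [v] to [D]: nonnegativity removes the absolute
    values, and points outside [D] contribute nothing since a positive power of 0 is 0. *)
Lemma ge0_hoelder (u v : T -> R) (p q : R) :
  measurable_fun D u -> measurable_fun D v ->
  (forall x, 0 <= u x) -> (forall x, 0 <= v x) ->
  0 < p -> 0 < q -> p^-1 + q^-1 = 1 ->
  (\int[mu]_(x in D) (u x * v x)%:E <=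
   (\int[mu]_(x in D) (u x `^ p)%:E) `^ p^-1 *
   (\int[mu]_(x in D) (v x `^ q)%:E) `^ q^-1)%E.
Proof.
move=> mfu mfv u0 v0 p0 q0 pq.
have := @hoelder _ _ _ mu (u \_ D) (v \_ D) p q.
rewrite Lnorm1 unlock/=.
have normE (w : T -> R) (r : R) : 0 < r -> (forall x, 0 <= w x) ->
    (\int[mu]_x `|((w \_ D) x)%:E| `^ r = \int[mu]_(x in D) (w x `^ r)%:E)%E.
  move=> r0 w0; rewrite [RHS]integral_mkcond; apply: eq_integral => x _ /=.
  rewrite /patch; case: ifPn => _; first by rewrite ger0_norm.
  by rewrite normr0 powR0// gt_eqF.
rewrite !normE// [X in (_ -> _ -> _ -> _ -> _ -> X <= _)%E -> _](_ : _ =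
    \int[mu]_(x in D) (u x * v x)%:E)%E; last first.
  rewrite [RHS]integral_mkcond; apply: eq_integral => x _ /=.
  rewrite /patch; case: ifPn => _; last by rewrite mulr0 normr0.
  by rewrite ger0_norm// mulr_ge0.
by apply => //; apply/(measurable_restrictT _ mD).
Qed.

Lemma ge0_hoelder4 (u1 u2 v1 v2 : T -> R) (p q : R) :
  measurable_fun D u1 -> measurable_fun D u2 ->
  measurable_fun D v1 -> measurable_fun D v2 ->
  (forall x, 0 <= u1 x) -> (forall x, 0 <= u2 x) ->
  (forall x, 0 <= v1 x) -> (forall x, 0 <= v2 x) ->
  0 < p -> 0 < q -> p^-1 + q^-1 = 1 ->
  (\int[mu]_(x in D) (u1 x * u2 x * (v1 x * v2 x))%:E <=
   (\int[mu]_(x in D) (u1 x `^ (p ^+ 2))%:E) `^ (1 / p ^+ 2) *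
   (\int[mu]_(x in D) (u2 x `^ (p * q))%:E) `^ (1 / (p * q)) *
   (\int[mu]_(x in D) (v1 x `^ (p * q))%:E) `^ (1 / (p * q)) *
   (\int[mu]_(x in D) (v2 x `^ (q ^+ 2))%:E) `^ (1 / q ^+ 2))%E.
Proof.
move=> mu1 mu2 mv1 mv2 u10 u20 v10 v20 p0 q0 pq.
have mpow (w : T -> R) r : measurable_fun D w ->
    measurable_fun D (fun x => w x `^ r).
  by move=> mw; apply: (measurableT_comp (measurable_powR r)).
(* Here [r] is the exponent, [p] or [q], that the outer inequality puts on a pair; Hoelder is
   applied to the [r]-th powers of [w1] and [w2]. *)
have inner (w1 w2 : T -> R) (r : R) : measurable_fun D w1 ->
    measurable_fun D w2 -> (forall x, 0 <= w1 x) -> (forall x, 0 <= w2 x) ->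
    0 < r ->
    ((\int[mu]_(x in D) ((w1 x * w2 x) `^ r)%:E) `^ r^-1 <=
     (\int[mu]_(x in D) (w1 x `^ (r * p))%:E) `^ (1 / (r * p)) *
     (\int[mu]_(x in D) (w2 x `^ (r * q))%:E) `^ (1 / (r * q)))%E.
  move=> mw1 mw2 w10 w20 r0.
  have int_ge0 (w : T -> R) s : (0 <= \int[mu]_(x in D) (w x `^ s)%:E)%E.
    by apply: integral_ge0 => x _; rewrite lee_fin powR_ge0.
  (* Both outer exponents contain the factor [r^-1]; pulling it out of the product leaves a
     comparison of bases, by monotonicity of the power on [[0, +oo]]. *)
  rewrite !div1r ![(r * _)^-1]invfM ![r^-1 * _]mulrC !poweRrM.
  rewrite -poweRM ?poweR_ge0//; apply: gt0_ler_poweR.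
  - by rewrite invr_ge0 ltW.
  - by rewrite in_itv/= int_ge0 leey.
  - by rewrite in_itv/= mule_ge0 ?poweR_ge0// leey.
  under eq_integral do rewrite powRM//.
  under [X in (_ <= X `^ _ * _)%E]eq_integral do rewrite powRrM.
  under [X in (_ <= _ * X `^ _)%E]eq_integral do rewrite powRrM.
  by apply: ge0_hoelder => // [||x|x]; rewrite ?powR_ge0//; exact: mpow.
rewrite -muleA.
apply: (@le_trans _ _
    ((\int[mu]_(x in D) ((u1 x * u2 x) `^ p)%:E) `^ p^-1 *
     (\int[mu]_(x in D) ((v1 x * v2 x) `^ q)%:E) `^ q^-1)%E).
  by apply: ge0_hoelder => // [||x|x];
    [exact: measurable_funM|exact: measurable_funM|rewrite mulr_ge0..].
apply: lee_pmul; rewrite ?poweR_ge0//.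
  by rewrite expr2; exact: inner.
by rewrite [p * q]mulrC expr2; exact: inner.
Qed.

End integral_inequalities.

Theorem theorem6 (R : realType) (a b : R) (J : set R) (h f g : R -> R) (p q : R)
    (a_gt0 : 0 < a)
    (J01 : `[0, 1] `<=` J)
    (h_ge0 : forall t, J t -> 0 <= h t)
    (hf : h_geometrically_convex h `[a, b] f)
    (hg : h_geometrically_convex h `[a, b] g)
    (p_gt1 : 1 < p)
    (pq : 1 / p + 1 / q = 1)
    (x y : R)
    (xI : x \in `[a, b])
    (yI : y \in `[a, b])
    (xy : x < y)
    (mfx : lebesgue_measurable_fun `[0, 1] (fun t => f x `^ (p ^+ 2 * h t)))
    (mgy : lebesgue_measurable_fun `[0, 1] (fun t => g y `^ (p * q * h t)))
    (mfy : lebesgue_measurable_fun `[0, 1]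
             (fun t => f y `^ (p * q * h (1 - t))))
    (mgx : lebesgue_measurable_fun `[0, 1]
             (fun t => g x `^ (q ^+ 2 * h (1 - t)))) :
  (integral01 (fun t => f (x `^ t * y `^ (1 - t)) * g (x `^ (1 - t) * y `^ t))%R
   <= integral01 (fun t => f x `^ (p ^+ 2 * h t))%R `^ (1 / p ^+ 2)
      * integral01 (fun t => g y `^ (p * q * h t))%R `^ (1 / (p * q))
      * integral01 (fun t => f y `^ (p * q * h (1 - t)))%R `^ (1 / (p * q))
      * integral01 (fun t => g x `^ (q ^+ 2 * h (1 - t)))%R `^ (1 / q ^+ 2))%E.
Proof.
have p0 : 0 < p by exact: lt_trans ltr01 p_gt1.
have pqV : p^-1 + q^-1 = 1 by move: pq; rewrite !div1r.
have q0 : 0 < q.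
  by rewrite -invr_gt0 -(addKr p^-1 q^-1) pqV addrC subr_gt0 invf_lt1.
case: hf hg => f0 fgc [g0 ggc].
have m01 : measurable (`[0, 1] : set (caratheodory_type (@wlength R idfun)^*%mu)).
  by apply: sub_caratheodory; exact: measurable_itv.
(* Hoelder needs the factors themselves to be measurable; they are the [r^-1]-th powers of the
   functions assumed measurable. *)
have mroot (c r : R) (k : R -> R) : 0 < r ->
    lebesgue_measurable_fun `[0, 1] (fun t => c `^ (r * k t)) ->
    lebesgue_measurable_fun `[0, 1] (fun t => c `^ k t).
  move=> r0 /(measurableT_comp (measurable_powR r^-1)).
  apply: eq_measurable_fun => t _ /=.
  by rewrite -powRrM mulrAC divff ?mul1r// gt_eqF.
rewrite /integral01.
have powE (c r : R) (k : R -> R) :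
    (\int[@completed_lebesgue_measure R]_(t in `[0%R, 1%R])
      (c `^ (r * k t))%:E =
    \int[@completed_lebesgue_measure R]_(t in `[0%R, 1%R])
      ((c `^ k t) `^ r)%:E)%E.
  by apply: eq_integral => t _; rewrite mulrC powRrM.
(* Treating the Hoelder bound first lets unification fix the intermediate integrand. *)
rewrite !powE; apply: le_trans; last first.
  apply: (ge0_hoelder4 _ m01 _ _ _ _ _ _ _ _ p0 q0 pqV);
    try (by move=> t; exact: powR_ge0).
  - by apply: mroot mfx; rewrite exprn_gt0.
  - by apply: mroot mgy; rewrite mulr_gt0.
  - by apply: (@mroot _ (p * q) (fun t => h (1 - t))) mfy; rewrite mulr_gt0.
  - by apply: (@mroot _ (q ^+ 2) (fun t => h (1 - t))) mgx; rewrite exprn_gt0.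
(* A weighted geometric mean stays in the interval: write each endpoint [c] as the product of its
   powers [t] and [1 - t], and compare factor by factor. *)
have xyI t : 0 <= t <= 1 -> x `^ t * y `^ (1 - t) \in `[a, b].
  move=> /andP[t0 t1]; have s0 : 0 <= 1 - t by rewrite subr_ge0.
  have powD c : 0 < c -> c `^ t * c `^ (1 - t) = c.
    by move=> c0; rewrite -powRD ?(gt_eqF c0) ?implybT// subrKC powRr1// ltW.
  move: xI yI; rewrite !in_itv/= => /andP[ax xb] /andP[ay yb].
  have b0 : 0 < b by rewrite (lt_le_trans a_gt0)// (le_trans ax).
  rewrite -{1}(powD a)// -{1}(powD b)//.
  by apply/andP; split; apply: ler_pM; rewrite ?powR_ge0// ge0_ler_powR//
    nnegrE ltW// (lt_le_trans a_gt0).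
have yxI t : 0 <= t <= 1 -> x `^ (1 - t) * y `^ t \in `[a, b].
  move=> t01; rewrite -{2}(subKr 1 t); apply: xyI.
  by rewrite subr_ge0 gerBl andbC.
apply: ge0_le_integral_nomeas => t; rewrite /= in_itv/= => t01; rewrite lee_fin.
  by rewrite mulr_ge0// ltW// ?f0 ?g0//; [exact: xyI|exact: yxI].
have s01 : 0 <= 1 - t <= 1 by rewrite subr_ge0 gerBl andbC.
have fle := fgc _ _ _ xI yI t01.
(* Convexity of [g] is taken at [1 - t], so [g y] receives the exponent [h t] and can be paired with
   [f x]. *)
have := ggc _ _ _ xI yI s01; rewrite subKr => gle.
apply: le_trans (ler_pM _ _ fle gle) _.
- exact/ltW/f0/xyI.
- exact/ltW/g0/yxI.
(* The four factors are regrouped from pairs sharing an exponent into pairs sharing a function. *)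
by rewrite [leRHS]mulrACA [X in _ <= _ * X]mulrC.
Qed.
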